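(* Consider the binary random graph affiliation mixture model with $Q\ge 2$ groups, on $Q+1$ nodes. Let $$U_Q(X)=\mathbb E\Big(\prod_{1\le i<j\le Q+1}(X-X_{ij})\Big),$$ a univariate polynomial of degree $\binom{Q+1}2$ in an indeterminate $X$ (expectation taken coefficientwise), and $$V_Q(X,Y)=\mathbb E\Big(\Big(X+(Q-1)Y-\sum_{1\le i\le Q}X_{i(Q+1)}\Big)\prod_{1\le i<j\le Q}(X-X_{ij})\Big),$$ of degree $\binom Q2+1$ in $X$ and degree $1$ in $Y$. Then $U_Q(\alpha)=0$ (so $\alpha$ is a real root of $U_Q$), $V_Q(\alpha,\beta)=0$, and the coefficient of $Y$ in $V_Q(\alpha,Y)$ is non-zero if and only if $\alpha\ne\beta$.
   Context: Random graph mixture model: nodes have i.i.d. latent groups $Z_i\in\{1,\dots,Q\}$ with $\pi_q=\mathbb P(Z_i=q)\in(0,1)$, $\sum_q\pi_q=1$; edge variables $X_{ij}$ ($i<j$) are conditionally independent given all $Z$'s, with law of $X_{ij}$ depending only on $(Z_i,Z_j)$. Binary affiliation model: $X_{ij}\in\{0,1\}$ with $\mathbb P(X_{ij}=1\mid Z_i=q,Z_j=l)=\alpha$ if $q=l$ and $=\beta$ if $q\ne l$. *)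

(* Defs.v *)
From HB Require Import structures.
From mathcomp Require Import all_boot all_order all_algebra.
Set Implicit Arguments. Unset Strict Implicit. Unset Printing Implicit Defensive.
Import Order.TTheory GRing.Theory Num.Theory.
Local Open Scope ring_scope.

Definition edge (n : nat) := {e : 'I_n * 'I_n | (e.1 < e.2)%N}.

Section Affiliation.
Variables (R : realFieldType) (Q : nat) (pi : 'I_Q -> R) (alpha beta : R).

Definition edge_prob (n : nat) (Z : {ffun 'I_n -> 'I_Q}) (e : edge n) : R :=
  if Z (sval e).1 == Z (sval e).2 then alpha else beta.

Definition bern (p : R) (b : bool) : R := if b then p else 1 - p.

Definition weight (n : nat) (Z : {ffun 'I_n -> 'I_Q}) (X : {ffun edge n -> bool}) : R :=
  (\prod_(i < n) pi (Z i)) * \prod_(e : edge n) bern (edge_prob Z e) (X e).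

Definition Epoly (n : nat) (F : {ffun 'I_n -> 'I_Q} -> {ffun edge n -> bool} -> {poly R})
  : {poly R} :=
  \sum_(Z : {ffun 'I_n -> 'I_Q}) \sum_(X : {ffun edge n -> bool}) (weight Z X)%:P * F Z X.

Definition Epoly2 (n : nat)
  (F : {ffun 'I_n -> 'I_Q} -> {ffun edge n -> bool} -> {poly {poly R}}) : {poly {poly R}} :=
  \sum_(Z : {ffun 'I_n -> 'I_Q}) \sum_(X : {ffun edge n -> bool})
     (weight Z X)%:P%:P * F Z X.

Definition U_Q : {poly R} :=
  Epoly (fun _ X => \prod_(e : edge Q.+1) ('X - ((X e : nat)%:R)%:P)).

(* V_Q(X,Y), represented in {poly {poly R}}: outer variable X, inner variable Y.
   V_Q = E((X + (Q-1) Y - sum_{i<=Q} X_{i,Q+1}) prod_{1<=i<j<=Q}(X - X_ij)) *)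
Definition V_Q : {poly {poly R}} :=
  Epoly2 (fun _ X =>
    ('X + ((Q.-1)%:R *: 'X)%:P
       - (\sum_(e : edge Q.+1 | (sval e).2 == ord_max) ((X e : nat)%:R : R))%:P%:P)
    * \prod_(e : edge Q.+1 | ((sval e).2 < Q)%N) ('X - ((X e : nat)%:R)%:P%:P)).

End Affiliation.

(* Main.v *)
Require Import Defs.
From HB Require Import structures.
From mathcomp Require Import all_boot all_order all_algebra.
Set Implicit Arguments. Unset Strict Implicit. Unset Printing Implicit Defensive.
Import Order.TTheory GRing.Theory Num.Theory.
Local Open Scope ring_scope.

(* Given the groups Z, the edge variables are independent Bernoulli variables
   and each factor (x - X_ij) is affine in its own edge variable, so the
   conditional expectation of these products is obtained by substituting the
   edge means p_ij(Z), which are alpha or beta.  Among Q+1 nodes two share a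
   group, so a factor alpha - p_ij vanishes: U_Q(alpha) = 0.  In V_Q the
   product over the first Q nodes vanishes unless they occupy all Q groups;
   then node Q+1 shares the group of exactly one of them, so
   sum_i p_(i,Q+1) = alpha + (Q-1) beta and V_Q(alpha, beta) = 0.  The
   Y-coefficient is (Q-1) (alpha - beta)^(Q choose 2) times the positive
   probability that the first Q nodes lie in distinct groups. *)

Section BernoulliExpectation.
Variables (R : realFieldType) (I : finType) (p : I -> R).

Definition Ebern (F : {ffun I -> bool} -> R) : R :=
  \sum_(X : {ffun I -> bool}) (\prod_i bern (p i) (X i)) * F X.

Lemma eq_Ebern F G : (forall X, F X = G X) -> Ebern F = Ebern G.
Proof. by move=> eqFG; apply: eq_bigr => X _; rewrite eqFG. Qed.

Lemma EbernZ c F : Ebern (fun X => c * F X) = c * Ebern F.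
Proof. by rewrite /Ebern big_distrr; apply: eq_bigr => X _; rewrite mulrCA. Qed.

Lemma EbernB F G : Ebern (fun X => F X - G X) = Ebern F - Ebern G.
Proof. by rewrite /Ebern -sumrB; apply: eq_bigr => X _; rewrite mulrBr. Qed.

Lemma Ebern_sum (J : Type) (r : seq J) (P : pred J) (F : J -> {ffun I -> bool} -> R) :
  Ebern (fun X => \sum_(j <- r | P j) F j X) = \sum_(j <- r | P j) Ebern (F j).
Proof.
rewrite /Ebern exchange_big; apply: eq_bigr => X _.
by rewrite big_distrr.
Qed.

Lemma Ebern_prod (f : I -> bool -> R) :
  Ebern (fun X => \prod_i f i (X i)) = \prod_i (p i * f i true + (1 - p i) * f i false).
Proof.
rewrite (eq_bigr (fun i => \sum_(b : bool) bern (p i) b * f i b)); last first.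
  by move=> i _; rewrite big_bool /= addrC.
rewrite bigA_distr_bigA /Ebern; apply: eq_bigr => X _.
by rewrite big_split.
Qed.

Lemma bern_mean_if (q a : R) (b : bool) :
  q * (if b then a - (true : nat)%:R else 1)
    + (1 - q) * (if b then a - (false : nat)%:R else 1)
  = if b then a - q else 1.
Proof.
case: b => /=; last by rewrite !mulr1 addrC subrK.
by rewrite subr0 mulrBr mulr1 mulrBl mul1r addrC addrA subrK.
Qed.

Lemma Ebern_prod_affine (A : pred I) a :
  Ebern (fun X => \prod_(i | A i) (a - (X i)%:R)) = \prod_(i | A i) (a - p i).
Proof.
rewrite (@eq_Ebern _ (fun X => \prod_i (if A i then a - (X i)%:R else 1))); last first.
  by move=> X; rewrite big_mkcond.
rewrite (Ebern_prod (fun i b => if A i then a - b%:R else 1)) [RHS]big_mkcond.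
by apply: eq_bigr => i _; apply: bern_mean_if.
Qed.

Lemma Ebern_coord_prod_affine (A : pred I) a j : ~~ A j ->
  Ebern (fun X => (X j)%:R * \prod_(i | A i) (a - (X i)%:R))
  = p j * \prod_(i | A i) (a - p i).
Proof.
move=> Aj; pose f i b : R := if i == j then b%:R else if A i then a - b%:R else 1.
have prod_off_j (g : I -> R) :
    \prod_(i | A i) g i = \prod_(i | i != j) (if A i then g i else 1).
  by rewrite big_mkcond (bigD1 j) //= (negbTE Aj) mul1r.
rewrite (@eq_Ebern _ (fun X => \prod_i f i (X i))); last first.
  move=> X; rewrite [RHS](bigD1 j) //= /f eqxx prod_off_j.
  by congr (_ * _); apply: eq_bigr => i /negbTE ->.
rewrite (Ebern_prod f) (bigD1 j) //= /f eqxx mulr1 mulr0 addr0 prod_off_j.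
by congr (_ * _); apply: eq_bigr => i /negbTE ->; apply: bern_mean_if.
Qed.

Lemma Ebern_affine_prod_affine (A B : pred I) c a :
    (forall i, B i -> ~~ A i) ->
  Ebern (fun X => (c - \sum_(i | B i) (X i)%:R) * \prod_(i | A i) (a - (X i)%:R))
  = (c - \sum_(i | B i) p i) * \prod_(i | A i) (a - p i).
Proof.
move=> disjBA; set P := fun X : {ffun I -> bool} => \prod_(i | A i) (a - (X i)%:R).
rewrite (@eq_Ebern _ (fun X => c * P X - \sum_(i | B i) (X i)%:R * P X)); last first.
  by move=> X; rewrite mulrBl big_distrl.
rewrite EbernB EbernZ (Ebern_sum _ _ (fun i (X : {ffun I -> bool}) => (X i)%:R * P X)).
rewrite Ebern_prod_affine mulrBl big_distrl /=; congr (_ - _).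
by apply: eq_bigr => i Bi; apply: Ebern_coord_prod_affine; apply: disjBA.
Qed.

End BernoulliExpectation.

Section AffiliationExpectation.
Variables (R : realFieldType) (Q : nat) (pi : 'I_Q -> R) (alpha beta : R).

Lemma sum_weight n (Z : {ffun 'I_n -> 'I_Q}) (F : {ffun edge n -> bool} -> R) :
  \sum_X weight pi alpha beta Z X * F X
  = (\prod_(i < n) pi (Z i)) * Ebern (edge_prob alpha beta Z) F.
Proof. by rewrite /Ebern big_distrr; apply: eq_bigr => X _; rewrite /weight -mulrA. Qed.

Lemma horner_Epoly n (F : {ffun 'I_n -> 'I_Q} -> {ffun edge n -> bool} -> {poly R}) x :
  (Epoly pi alpha beta F).[x] = \sum_(Z : {ffun 'I_n -> 'I_Q})
    (\prod_(i < n) pi (Z i)) * Ebern (edge_prob alpha beta Z) (fun X => (F Z X).[x]).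
Proof.
rewrite horner_sum; apply: eq_bigr => Z _.
by rewrite horner_sum -sum_weight; apply: eq_bigr => X _; rewrite hornerCM.
Qed.

Lemma coef_Epoly n (F : {ffun 'I_n -> 'I_Q} -> {ffun edge n -> bool} -> {poly R}) k :
  (Epoly pi alpha beta F)`_k = \sum_(Z : {ffun 'I_n -> 'I_Q})
    (\prod_(i < n) pi (Z i)) * Ebern (edge_prob alpha beta Z) (fun X => (F Z X)`_k).
Proof.
rewrite coef_sum; apply: eq_bigr => Z _.
by rewrite coef_sum -sum_weight; apply: eq_bigr => X _; rewrite coefCM.
Qed.

Lemma horner_Epoly2C n
    (F : {ffun 'I_n -> 'I_Q} -> {ffun edge n -> bool} -> {poly {poly R}}) c :
  (Epoly2 pi alpha beta F).[c%:P] = Epoly pi alpha beta (fun Z X => (F Z X).[c%:P]).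
Proof.
rewrite horner_sum; apply: eq_bigr => Z _.
by rewrite horner_sum; apply: eq_bigr => X _; rewrite hornerCM.
Qed.

End AffiliationExpectation.

Definition widen_edge n (e : edge n) : edge n.+1 :=
  exist _ (widen_ord (leqnSn n) (sval e).1, widen_ord (leqnSn n) (sval e).2) (svalP e).

Lemma widen_edgeP n (e : edge n.+1) :
  ((sval e).2 < n)%N -> exists e' : edge n, e = widen_edge e'.
Proof.
case: e => [[a b] lt_ab] /= lt_bn; have lt_an := ltn_trans lt_ab lt_bn.
exists (exist _ (Ordinal lt_an, Ordinal lt_bn) lt_ab).
by apply: val_inj; congr pair; apply: val_inj.
Qed.

Lemma edge_of_not_injective n (T : eqType) (f : 'I_n -> T) :
  ~~ injectiveb f -> exists e : edge n, f (sval e).1 == f (sval e).2.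
Proof.
case/injectivePn => i [j] neq_ij eq_fij.
case: (ltngtP i j) => [lt_ij | lt_ji | eq_ij].
- by exists (exist _ (i, j) lt_ij); rewrite /= eq_fij.
- by exists (exist _ (j, i) lt_ji); rewrite /= eq_fij.
- by rewrite (val_inj eq_ij) eqxx in neq_ij.
Qed.

Definition edge_to_last n (i : 'I_n) : edge n.+1 :=
  exist _ (widen_ord (leqnSn n) i, ord_max) (ltn_ord i).

Lemma big_edges_to_last (R : Type) (idx : R) (op : Monoid.com_law idx) n
    (F : edge n.+1 -> R) :
  \big[op/idx]_(e : edge n.+1 | (sval e).2 == ord_max) F e
  = \big[op/idx]_(i < n) F (edge_to_last i).
Proof.
rewrite (reindex_omap (@edge_to_last n) (fun e => insub (val (sval e).1))) /=.
  by apply: eq_bigl => i; rewrite eqxx valK eqxx.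
move=> [[a b] lt_ab] /= /eqP eq_b; subst b.
rewrite (insubT (fun k => k < n)%N lt_ab) /=.
by congr Some; apply: val_inj; congr pair; apply: val_inj.
Qed.

Lemma sum_if_injective_eq (R : nzRingType) (T : finType) (f : T -> T) y (a b : R) :
  injective f -> \sum_x (if f x == y then a else b) = a + (#|T|.-1)%:R * b.
Proof.
move=> inj_f; have [x0 <-] : exists x0, f x0 = y.
  by have /codomP[x0 ->] := inj_card_onto inj_f (leqnn _) y; exists x0.
rewrite (bigD1 x0) //= eqxx; congr (_ + _).
rewrite (eq_bigr (fun _ => b)); last first.
  by move=> x /negbTE neq_x; rewrite (inj_eq inj_f) neq_x.
by rewrite sumr_const cardC1 mulr_natl.
Qed.

Definition separates_first Q (Z : {ffun 'I_Q.+1 -> 'I_Q}) : bool :=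
  injectiveb (fun i : 'I_Q => Z (widen_ord (leqnSn Q) i)).

Section AffiliationRoots.
Variables (R : realFieldType) (Q : nat) (pi : 'I_Q -> R) (alpha beta : R).

Lemma U_Q_root : (U_Q pi alpha beta).[alpha] = 0.
Proof.
rewrite horner_Epoly big1 // => Z _.
have [e Ze] : exists e : edge Q.+1, Z (sval e).1 == Z (sval e).2.
  by apply: edge_of_not_injective; apply/injectiveP => /leq_card; rewrite !card_ord ltnn.
under eq_Ebern => X do rewrite horner_prod (eq_bigr _ (fun e _ => hornerXsubC _ _)).
rewrite (Ebern_prod_affine _ xpredT) (bigD1 e) //= /edge_prob Ze.
by rewrite subrr mul0r mulr0.
Qed.

Lemma prod_inner_edges (Z : {ffun 'I_Q.+1 -> 'I_Q}) :
  \prod_(e : edge Q.+1 | ((sval e).2 < Q)%N) (alpha - edge_prob alpha beta Z e)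
  = if separates_first Z then \prod_(e : edge Q.+1 | ((sval e).2 < Q)%N) (alpha - beta)
    else 0.
Proof.
case: ifP => [/injectiveP sepZ | /negbT /edge_of_not_injective [e Ze]].
  apply: eq_bigr => _ /widen_edgeP [e ->]; rewrite /edge_prob /=.
  by case: eqP => // /sepZ eq_e; move: (svalP e); rewrite eq_e ltnn.
rewrite (bigD1 (widen_edge e)) /=; last exact: ltn_ord.
by rewrite /edge_prob Ze subrr mul0r.
Qed.

Lemma sum_last_edges (Z : {ffun 'I_Q.+1 -> 'I_Q}) : separates_first Z ->
  \sum_(e : edge Q.+1 | (sval e).2 == ord_max) edge_prob alpha beta Z e
  = alpha + (Q.-1)%:R * beta.
Proof.
move/injectiveP => sepZ; rewrite big_edges_to_last -[in RHS](card_ord Q).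
by rewrite -(sum_if_injective_eq (Z ord_max) alpha beta sepZ).
Qed.

Lemma horner_V_Q_C : (V_Q pi alpha beta).[alpha%:P] = Epoly pi alpha beta (fun _ X =>
  (alpha%:P + (Q.-1)%:R *: 'X
     - (\sum_(e : edge Q.+1 | (sval e).2 == ord_max) ((X e)%:R : R))%:P)
  * (\prod_(e : edge Q.+1 | ((sval e).2 < Q)%N) (alpha - (X e)%:R))%:P).
Proof.
rewrite horner_Epoly2C; apply: eq_bigr => Z _; apply: eq_bigr => X _; congr (_ * _).
rewrite hornerM !hornerD hornerN !hornerC hornerX horner_prod rmorph_prod.
by congr (_ * _); apply: eq_bigr => e _; rewrite hornerXsubC -polyCB.
Qed.

Lemma V_Q_root : ((V_Q pi alpha beta).[alpha%:P]).[beta] = 0.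
Proof.
rewrite horner_V_Q_C horner_Epoly big1 // => Z _.
under eq_Ebern => X do rewrite hornerM hornerC !hornerD hornerN hornerZ hornerX !hornerC.
rewrite Ebern_affine_prod_affine; last by move=> e /eqP ->; rewrite /= ltnn.
rewrite prod_inner_edges; case: ifP => sepZ; last by rewrite !mulr0.
by rewrite sum_last_edges // subrr mul0r mulr0.
Qed.

Lemma coef1_V_Q : ((V_Q pi alpha beta).[alpha%:P])`_1
  = (Q.-1)%:R * \prod_(e : edge Q.+1 | ((sval e).2 < Q)%N) (alpha - beta)
    * \sum_(Z | separates_first Z) \prod_(i < Q.+1) pi (Z i).
Proof.
rewrite horner_V_Q_C coef_Epoly [RHS]big_distrr [RHS]big_mkcond /=.
apply: eq_bigr => Z _.
under eq_Ebern => X do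
  rewrite coefMC !coefD coefN coefZ coefX !coefC /= add0r subr0 mulr1.
rewrite EbernZ Ebern_prod_affine prod_inner_edges.
by case: ifP => _; rewrite ?mulr0 // mulrC.
Qed.

Lemma separating_weight_gt0 : (0 < Q)%N -> (forall q, 0 < pi q) ->
  0 < \sum_(Z | separates_first Z) \prod_(i < Q.+1) pi (Z i).
Proof.
move=> Q_gt0 pi_gt0.
pose Z0 : {ffun 'I_Q.+1 -> 'I_Q} := [ffun j => insubd (Ordinal Q_gt0) (val j)].
have sepZ0 : separates_first Z0.
  apply/injectiveP => i j; rewrite !ffunE => /(congr1 val).
  by rewrite /= !val_insubd !ltn_ord => /val_inj.
rewrite (bigD1 Z0) //=; apply: ltr_wpDr; last exact: prodr_gt0.
by apply: sumr_ge0 => Z _; apply/ltW/prodr_gt0.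
Qed.

End AffiliationRoots.

Lemma inner_edges_prod_const_neq0 (R : idomainType) Q (c : R) : (1 < Q)%N ->
  (\prod_(e : edge Q.+1 | ((sval e).2 < Q)%N) c != 0) = (c != 0).
Proof.
move=> Q_gt1; have e0 : edge Q := exist _ (Ordinal (ltnW Q_gt1), Ordinal Q_gt1) isT.
have inner_gt0 : (0 < #|(fun e : edge Q.+1 => ((sval e).2 < Q)%N)|)%N.
  by apply/card_gt0P; exists (widen_edge e0); rewrite unfold_in /= ltn_ord.
by rewrite prodr_const expf_eq0 inner_gt0.
Qed.

Theorem proposition1 (R : realFieldType) (Q : nat) (hQ : (2 <= Q)%N)
  (pi : 'I_Q -> R) (hpi : forall q, 0 < pi q < 1) (hsum : \sum_(q < Q) pi q = 1)
  (alpha beta : R) (ha : 0 <= alpha <= 1) (hb : 0 <= beta <= 1) :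
  (U_Q pi alpha beta).[alpha] = 0 /\
  ((V_Q pi alpha beta).[alpha%:P]).[beta] = 0 /\
  (((V_Q pi alpha beta).[alpha%:P])`_1 != 0 <-> alpha != beta).
Proof.
split; first exact: U_Q_root.
split; first exact: V_Q_root.
have pi_gt0 q : 0 < pi q by case/andP: (hpi q).
have weight_gt0 := separating_weight_gt0 (ltnW hQ) pi_gt0.
have pred_Q_neq0 : (Q.-1)%:R != 0 :> R by rewrite pnatr_eq0 -lt0n ltn_predRL.
rewrite coef1_V_Q !mulf_eq0 !negb_or pred_Q_neq0 inner_edges_prod_const_neq0 //.
by rewrite subr_eq0 (gt_eqF weight_gt0) andbT.
Qed.
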